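(* Let $a,b$ be two distinct non-constant polynomials in $\mathbb{F}_2[t]$. Let $\sigma$ be the morphism on words over the two-letter alphabet $\{a,b\}$ defined by $\sigma(a)=ab$, $\sigma(b)=aa$, and let $\sigma^\infty(a)=abaaabababaaabaa\ldots=(s_0,s_1,s_2,\ldots)$ be its fixed point beginning with $a$ (the period-doubling sequence on $a,b$). Let $\alpha_\mathbf{p}=[s_0;s_1,s_2,\ldots]=[a;b,a,a,a,b,a,\ldots]\in\mathbb{F}_2((1/t))$ be the infinite continued fraction whose partial quotients are the successive letters of $\sigma^\infty(a)$, each letter interpreted as the corresponding polynomial. Define $P(x)\in\mathbb{F}_2(t)[x]$ by $$P(x)=Ax^4+Bx^3+Cx^2+1,\qquad A=ab+b^2+1,\quad B=ab(a+b),\quad C=ab.$$ Then $P(\alpha_\mathbf{p})=0$.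
   Context: $\mathbb{F}_2((1/t))$ is the field of formal Laurent series in $1/t$ over $\mathbb{F}_2$, with absolute value $|0|=0$, $|\alpha|=|t|^n$ if $\alpha=t^n+\sum_{i<n}c_it^i$ (for a fixed real $|t|>1$). For $a_0\in\mathbb{F}_2[t]$ and $a_i\in\mathbb{F}_2[t]$ of positive degree for $i\ge1$, the infinite continued fraction $[a_0;a_1,a_2,\ldots]=a_0+\cfrac{1}{a_1+\cfrac{1}{a_2+\cdots}}$ denotes the limit in $\mathbb{F}_2((1/t))$ of the finite continued fractions $[a_0;a_1,\ldots,a_n]$. *)

(* Defs.v *)
From HB Require Import structures.
From mathcomp Require Import all_boot all_order all_algebra.
From mathcomp Require Import generic_quotient fraction.
From mathcomp Require Import zify ring lra.
From mathcomp Require Import boolp classical_sets fsbigop reals.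
From mathcomp Require Import topology normedtype sequences.

Set Implicit Arguments.
Unset Strict Implicit.
Unset Printing Implicit Defensive.

Import Order.TTheory GRing.Theory Num.Theory.
Import numFieldNormedType.Exports.
Local Open Scope quotient_scope.
Local Open Scope classical_set_scope.
Local Open Scope ring_scope.

Section LaurentSeries.
Variable K : fieldType.

Definition bounded_above_by (N : int) (f : int -> K) : Prop :=
  forall i, N < i -> f i = 0.

Definition has_bounded_support (f : int -> K) : bool :=
  `[< exists N, bounded_above_by N f >].

(* The field K((1/t)): [f i] is the coefficient of t^i, and it vanishes for i
   large. *)
Record laurent := Laurent {
  lcoef :> int -> K;
  lcoefP : has_bounded_support lcoef }.

HB.instance Definition _ := [isSub for lcoef].
HB.instance Definition _ := [Choice of laurent by <:].

Lemma lcoef_bound (f : laurent) : exists N, bounded_above_by N f.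
Proof. by case: f => f /= /asboolP. Qed.

Lemma laurentP (f g : laurent) : (forall i, f i = g i) -> f = g.
Proof. by move=> fg; apply/val_inj/funext. Qed.

Lemma bounded_le N M f : N <= M -> bounded_above_by N f -> bounded_above_by M f.
Proof. by move=> NM fN i Mi; apply: fN; exact: le_lt_trans NM Mi. Qed.

Lemma has_bounded_supportI N f : bounded_above_by N f -> has_bounded_support f.
Proof. by move=> fN; apply/asboolP; exists N. Qed.

Lemma bounded_cst0 N : bounded_above_by N (fun=> 0). Proof. by []. Qed.

Lemma bounded_delta : bounded_above_by 0 (fun i => (i == 0)%:R).
Proof. by move=> i i0; rewrite gt_eqF. Qed.

Lemma bounded_opp N f : bounded_above_by N f -> bounded_above_by N (fun i => - f i).
Proof. by move=> fN i /fN ->; rewrite oppr0. Qed.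

Lemma bounded_add N f g : bounded_above_by N f -> bounded_above_by N g ->
  bounded_above_by N (fun i => f i + g i).
Proof. by move=> fN gN i Ni; rewrite fN// gN// addr0. Qed.

Lemma has_bounded_opp (f : laurent) : has_bounded_support (fun i => - f i).
Proof.
by have [N fN] := lcoef_bound f; apply: (@has_bounded_supportI N); exact: bounded_opp.
Qed.

Lemma has_bounded_add (f g : laurent) : has_bounded_support (fun i => f i + g i).
Proof.
have [N fN] := lcoef_bound f; have [M gM] := lcoef_bound g.
apply: (@has_bounded_supportI (Num.max N M)); apply: bounded_add.
  by apply: bounded_le fN; rewrite le_max lexx.
by apply: bounded_le gM; rewrite le_max lexx orbT.
Qed.

Definition lzero := Laurent (has_bounded_supportI (@bounded_cst0 0)).
Definition lone := Laurent (has_bounded_supportI bounded_delta).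
Definition lopp f := Laurent (has_bounded_opp f).
Definition ladd f g := Laurent (has_bounded_add f g).

Lemma laddA : associative ladd.
Proof. by move=> f g h; apply: laurentP => i /=; rewrite addrA. Qed.
Lemma laddC : commutative ladd.
Proof. by move=> f g; apply: laurentP => i /=; rewrite addrC. Qed.
Lemma ladd0 : left_id lzero ladd.
Proof. by move=> f; apply: laurentP => i /=; rewrite add0r. Qed.
Lemma laddN : left_inverse lzero lopp ladd.
Proof. by move=> f; apply: laurentP => i /=; rewrite addNr. Qed.

HB.instance Definition _ := GRing.isZmodule.Build laurent laddA laddC ladd0 laddN.

Definition convolution (f g : int -> K) (k : int) : K :=
  \sum_(i \in [set: int]) f i * g (k - i).

Lemma convolution_seq (r : seq int) f g k : uniq r ->
  (forall i, i \notin r -> f i * g (k - i) = 0) ->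
  convolution f g k = \sum_(i <- r) f i * g (k - i).
Proof.
move=> ur r0; rewrite /convolution.
have -> : [set: int] = [set` predT] by apply/seteqP; split.
rewrite -(@bigfs _ _ _ _ r)//.
by move=> i _; exact: r0.
Qed.

Lemma convolution_bounded N M f g :
  bounded_above_by N f -> bounded_above_by M g ->
  bounded_above_by (N + M) (convolution f g).
Proof.
move=> fN gM k NMk; apply: fsbig1 => i _.
have [Ni|iN] := ltP N i; first by rewrite fN// mul0r.
by rewrite gM ?mulr0//; lia.
Qed.

Lemma convolutionE N M f g (n : nat) :
  bounded_above_by N f -> bounded_above_by M g ->
  convolution f g (N + M - n%:Z) =
  \sum_(j < n.+1) f (N - j%:Z) * g (M - (n - j)%N%:Z).
Proof.
move=> fN gM.
rewrite (@convolution_seq [seq N - Posz j | j <- iota 0 n.+1]).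
- rewrite big_map -[iota 0 n.+1]/(index_iota 0 n.+1) big_mkord.
  apply: eq_bigr => j _; congr (_ * g _).
  by have := ltn_ord j; lia.
- by rewrite map_inj_uniq ?iota_uniq// => i j; lia.
- move=> i iNr.
  have [Ni|iN] := ltP N i; first by rewrite fN// mul0r.
  rewrite gM ?mulr0//; rewrite ltNge; apply: contra iNr => H.
  by apply/mapP; exists (absz (N - i)%R); rewrite ?mem_iota; lia.
Qed.

Lemma has_bounded_mul (f g : laurent) : has_bounded_support (convolution f g).
Proof.
have [N fN] := lcoef_bound f; have [M gM] := lcoef_bound g.
by apply: (@has_bounded_supportI (N + M)); exact: convolution_bounded.
Qed.

Definition lmul f g := Laurent (has_bounded_mul f g).

Let trunc N m (f : int -> K) : {poly K} := \poly_(j < m) f (N - j%:Z).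

Let lmul_trunc N M m f g (n : nat) : (n < m)%N ->
  bounded_above_by N f -> bounded_above_by M g ->
  convolution f g (N + M - n%:Z) = (trunc N m f * trunc M m g)`_n.
Proof.
move=> nm fN gM; rewrite convolutionE// coefM; apply: eq_bigr => j _.
by rewrite !coef_poly !ifT//; have := ltn_ord j; lia.
Qed.

Lemma lmulA : associative lmul.
Proof.
move=> f g h; apply: laurentP => k /=.
have [N fN] := lcoef_bound f; have [M gM] := lcoef_bound g.
have [P hP] := lcoef_bound h.
have ghMP := convolution_bounded gM hP; have fgNM := convolution_bounded fN gM.
have [kl|lk] := ltP (N + (M + P)) k.
  rewrite (convolution_bounded fN ghMP)// (convolution_bounded fgNM hP)//; lia.
pose n := (absz (N + (M + P) - k)%R).
transitivity ((trunc N n.+1 f * (trunc M n.+1 g * trunc P n.+1 h))`_n).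
  have -> : k = N + (M + P) - n%:Z by lia.
  rewrite (lmul_trunc (m := n.+1))// !coefM; apply: eq_bigr => j _; congr (_ * _).
  by rewrite coef_poly ifT ?(lmul_trunc (m := n.+1))//; lia.
rewrite mulrA; have -> : k = N + M + P - n%:Z by lia.
rewrite (lmul_trunc (m := n.+1))// !coefM; apply: eq_bigr => j _; congr (_ * _).
by rewrite [RHS]coef_poly ifT ?(lmul_trunc (m := n.+1))//; have := ltn_ord j; lia.
Qed.

Lemma lmulC : commutative lmul.
Proof.
move=> f g; apply: laurentP => k /=; rewrite /convolution.
rewrite (reindex_fsbigT (fun i => k - i)); last first.
  by exists (fun i => k - i) => i; lia.
by apply: eq_fsbigr => i _; rewrite mulrC; congr (g _ * _); lia.
Qed.

Lemma lmul1 : left_id lone lmul.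
Proof.
move=> f; apply: laurentP => k /=.
rewrite (@convolution_seq [:: 0])// ?big_seq1 ?eqxx ?mul1r ?subr0//.
by move=> i; rewrite inE => /negPf ->; rewrite mul0r.
Qed.

Lemma lmulDl : left_distributive lmul ladd.
Proof.
move=> f g h; apply: laurentP => k /=.
have [N fN] := lcoef_bound f; have [M gM] := lcoef_bound g.
have [P hP] := lcoef_bound h.
pose Q := Num.max N M.
have fQ : bounded_above_by Q f by apply: bounded_le fN; rewrite le_max lexx.
have gQ : bounded_above_by Q g by apply: bounded_le gM; rewrite le_max lexx orbT.
have fgQ := bounded_add fQ gQ.
have [kl|lk] := ltP (Q + P) k.
  by rewrite !(@convolution_bounded Q P)// addr0.
have -> : k = Q + P - (absz (Q + P - k)%R)%:Z by lia.
rewrite !convolutionE// -big_split; apply: eq_bigr => j _ /=.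
by rewrite mulrDl.
Qed.

Lemma lone_neq0 : lone != 0.
Proof.
by apply/eqP => /(congr1 (fun f : laurent => f 0)) /= /eqP; rewrite oner_eq0.
Qed.

HB.instance Definition _ :=
  GRing.Zmodule_isComNzRing.Build laurent lmulA lmulC lmul1 lmulDl lone_neq0.

Lemma lcoef0 i : (0 : laurent) i = 0. Proof. by []. Qed.
Lemma lcoef1 i : (1 : laurent) i = (i == 0)%:R. Proof. by []. Qed.
Lemma lcoefD (f g : laurent) i : (f + g) i = f i + g i. Proof. by []. Qed.
Lemma lcoefN (f : laurent) i : (- f) i = - f i. Proof. by []. Qed.
Lemma lcoefB (f g : laurent) i : (f - g) i = f i - g i. Proof. by []. Qed.
Lemma lcoefM (f g : laurent) i : (f * g) i = convolution f g i. Proof. by []. Qed.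

Definition has_degree (f : int -> K) (n : int) : Prop :=
  f n != 0 /\ bounded_above_by n f.

Lemma has_degree_inj f n m : has_degree f n -> has_degree f m -> n = m.
Proof.
move=> [fn0 fn] [fm0 fm]; case: (ltgtP n m) => // [/fn|/fm] /eqP.
  by rewrite (negPf fm0).
by rewrite (negPf fn0).
Qed.

Lemma has_degreeM f g n m : has_degree f n -> has_degree g m ->
  has_degree (convolution f g) (n + m).
Proof.
move=> [fn0 fn] [gm0 gm]; split; last exact: convolution_bounded.
rewrite -[n + m]subr0 convolutionE// big_ord1 /= !subr0.
by rewrite mulf_neq0.
Qed.

Lemma has_degree_ex_le N (f : laurent) : f != 0 -> bounded_above_by N f ->
  exists2 n, n <= N & has_degree f n.
Proof.
move=> f0 fN; have [i fi0] : exists i, f i != 0.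
  apply/not_existsP => fi; move/eqP: f0; apply; apply: laurentP => i.
  by apply/eqP/negPn/negP/fi.
have iN : i <= N by rewrite leNgt; apply/negP => /fN /eqP; rewrite (negPf fi0).
have ex : exists k : nat, f (N - k%:Z) != 0.
  exists (absz (N - i)%R); have -> // : N - (absz (N - i)%R)%:Z = i by lia.
case: (ex_minnP ex) => k fk mink; exists (N - k%:Z); first by lia.
split=> // j kj; have [/fN//|jN] := ltP N j.
apply/eqP/negPn/negP => fj; have := mink (absz (N - j)%R).
have -> : N - (absz (N - j)%R)%:Z = j by lia.
by move=> /(_ fj); lia.
Qed.

Lemma has_degree_ex (f : laurent) : f != 0 -> exists n, has_degree f n.
Proof.
move=> f0; have [N fN] := lcoef_bound f.
by have [n _ fn] := has_degree_ex_le f0 fN; exists n.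
Qed.

Section Inverse.
Variables (f : laurent) (N : int).
Hypothesis fN : has_degree f N.

Let inv_coefs := fix inv_coefs n : seq K := if n is m.+1 then
  let s := inv_coefs m in
  rcons s ((f N)^-1 * ((m == 0)%:R - \sum_(j < m) f (N - j.+1%:Z) * s`_(m - j.+1)))
  else [::].

Let size_inv n : size (inv_coefs n) = n.
Proof. by elim: n => //= n IH; rewrite size_rcons IH. Qed.

Let b n := (inv_coefs n.+1)`_n.

Let nth_inv n j : (j < n)%N -> (inv_coefs n)`_j = b j.
Proof.
elim: n => // n IH; rewrite ltnS leq_eqVlt => /orP[/eqP->//|jn].
by rewrite /= nth_rcons size_inv jn IH.
Qed.

Let b_rec n : \sum_(j < n.+1) f (N - j%:Z) * b (n - j) = (n == 0)%:R.
Proof.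
rewrite big_ord_recl /= subr0 subn0 {1}/b /= nth_rcons size_inv ltnn eqxx.
rewrite mulrA mulfV ?mul1r; last by case: fN.
apply/eqP; rewrite -addrA addrC eq_sym -subr_eq subrr eq_sym addrC subr_eq0; apply/eqP.
apply: eq_bigr => j _; rewrite nth_inv //.
by have := ltn_ord j; lia.
Qed.

Let invf i : K := if i <= - N then b (absz (- N - i)%R) else 0.

Let invf_bounded : bounded_above_by (- N) invf.
Proof. by move=> i; rewrite /invf ltNge => /negPf ->. Qed.

Lemma laurent_inv_ex : exists g : laurent, g * f = 1.
Proof.
exists (Laurent (has_bounded_supportI invf_bounded)); rewrite mulrC.
apply: laurentP => k; rewrite lcoefM lcoef1 /=.
have [k0|k0] := ltP 0 k.
  by rewrite (convolution_bounded fN.2 invf_bounded) ?subrr// gt_eqF.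
have -> : k = N + - N - (absz (k)%R)%:Z by lia.
rewrite (convolutionE _ fN.2 invf_bounded).
have -> : (N + - N - (absz (k)%R)%:Z == 0) = ((absz (k)%R) == 0) by lia.
rewrite -b_rec; apply: eq_bigr => j _; congr (_ * _).
have jk := ltn_ord j; rewrite /invf ifT; last by lia.
by congr (b _); lia.
Qed.

End Inverse.

Definition linv (f : laurent) : laurent :=
  if f == 0 then 0 else xget 0 [set g | g * f = 1].

Lemma lmulVf (f : laurent) : f != 0 -> linv f * f = 1.
Proof.
move=> f0; rewrite /linv (negPf f0); have [n fn] := has_degree_ex f0.
exact: (xgetPex 0 (laurent_inv_ex fn)).
Qed.

Lemma linv0 : linv 0 = 0. Proof. by rewrite /linv eqxx. Qed.

HB.instance Definition _ := GRing.ComNzRing_isField.Build laurent lmulVf linv0.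

Lemma has_degree_neq0 (f : laurent) n : has_degree f n -> f != 0.
Proof. by move=> [fn _]; apply: contraNneq fn => ->. Qed.

Lemma has_degreeV (f : laurent) n : has_degree f n -> has_degree f^-1 (- n).
Proof.
move=> fn; have f0 := has_degree_neq0 fn.
have /has_degree_ex [m fm] : f^-1 != 0 by rewrite invr_eq0.
have d1 : has_degree (f / f) (n + m) := has_degreeM fn fm.
rewrite divff// in d1.
have d0 : has_degree (1 : laurent) 0.
  by split; [rewrite lcoef1 eqxx oner_eq0|exact: bounded_delta].
by have := has_degree_inj d1 d0 => nm; have -> : - n = m by lia.
Qed.

Definition poly_coef (p : {poly K}) (i : int) : K :=
  if i is Posz n then p`_n else 0.

Lemma poly_coef_bounded (p : {poly K}) : bounded_above_by (size p)%:Z (poly_coef p).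
Proof. by case=> // n; rewrite ltz_nat => pn /=; rewrite nth_default// ltnW. Qed.

Definition laurent_of_poly p := Laurent (has_bounded_supportI (@poly_coef_bounded p)).

Lemma laurent_of_poly_is_zmod_morphism : zmod_morphism laurent_of_poly.
Proof.
by move=> p r; apply: laurentP => i; rewrite lcoefB; case: i => n /=; rewrite ?coefB ?subr0.
Qed.

Lemma laurent_of_poly_is_monoid_morphism : monoid_morphism laurent_of_poly.
Proof.
split; first by apply: laurentP => -[n|n]; rewrite lcoef1 //= coef1.
move=> p r; apply: laurentP => k; rewrite lcoefM.
case: k => n /=; last first.
  rewrite /convolution fsbig1// => -[i|i] _ /=; last by rewrite mul0r.
  have -> : Negz n - i%:Z = Negz (n + i) by lia.
by rewrite mulr0.
rewrite (@convolution_seq [seq Posz j | j <- iota 0 n.+1]).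
- rewrite big_map -[iota 0 n.+1]/(index_iota 0 n.+1) big_mkord coefM.
  by apply: eq_bigr => j _ /=; rewrite subzn //; have := ltn_ord j; lia.
- by rewrite map_inj_uniq ?iota_uniq// => i j [].
- case=> i; last by rewrite mul0r.
  rewrite mem_map; last by move=> ? ? [].
  rewrite mem_iota /= => ni.
  have -> : n%:Z - i%:Z = Negz (i - n).-1 by lia.
by rewrite mulr0.
Qed.

HB.instance Definition _ := GRing.isZmodMorphism.Build {poly K} laurent
  laurent_of_poly laurent_of_poly_is_zmod_morphism.
HB.instance Definition _ := GRing.isMonoidMorphism.Build {poly K} laurent
  laurent_of_poly laurent_of_poly_is_monoid_morphism.

Lemma laurent_of_poly_inj : injective laurent_of_poly.
Proof.
move=> p r pr; apply/polyP => n.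
by have := congr1 (fun f : laurent => f n%:Z) pr.
Qed.

Definition laurent_of_ratfun (x : {fraction {poly K}}) : laurent :=
  laurent_of_poly (\n_(repr x)) / laurent_of_poly (\d_(repr x)).

Let denom_neq0 (x : {ratio {poly K}}) : laurent_of_poly (\d_x) != 0.
Proof.
by rewrite -(rmorph0 laurent_of_poly) (inj_eq laurent_of_poly_inj) denom_ratioP.
Qed.

Lemma laurent_of_ratfun_pi (r : {ratio {poly K}}) :
  laurent_of_ratfun (\pi_{fraction {poly K}} r) =
  laurent_of_poly (\n_r) / laurent_of_poly (\d_r).
Proof.
apply/eqP; rewrite eqr_div// -!rmorphM; apply/eqP; congr laurent_of_poly.
by rewrite FracField.equivf_l mulrC.
Qed.

Lemma laurent_of_ratfun_is_zmod_morphism : zmod_morphism laurent_of_ratfun.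
Proof.
elim/quotW => x; elim/quotW => y.
have -> : \pi_{fraction {poly K}} x - \pi_{fraction {poly K}} y =
    \pi_{fraction {poly K}} (FracField.addf x (FracField.oppf y)).
  by rewrite FracField.pi_add FracField.pi_opp.
rewrite !laurent_of_ratfun_pi /FracField.addf /FracField.oppf.
rewrite !numden_Ratio ?mulf_neq0 ?denom_ratioP//.
rewrite (rmorphD laurent_of_poly) !(rmorphM laurent_of_poly) (rmorphN laurent_of_poly).
by rewrite -mulNr [RHS]addf_div ?denom_neq0.
Qed.

Lemma laurent_of_ratfun_is_monoid_morphism : monoid_morphism laurent_of_ratfun.
Proof.
split.
  have -> : 1 = \pi_{fraction {poly K}} (Ratio 1 1).
    by rewrite -tofrac1 piE.
  by rewrite laurent_of_ratfun_pi !numden_Ratio ?oner_eq0// divff// rmorph1 oner_eq0.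
elim/quotW => x; elim/quotW => y.
have -> : \pi_{fraction {poly K}} x * \pi_{fraction {poly K}} y =
    \pi_{fraction {poly K}} (FracField.mulf x y).
  by rewrite FracField.pi_mul.
rewrite !laurent_of_ratfun_pi /FracField.mulf.
rewrite !numden_Ratio ?mulf_neq0 ?denom_ratioP//.
by rewrite !(rmorphM laurent_of_poly) [RHS]mulf_div.
Qed.

HB.instance Definition _ := GRing.isZmodMorphism.Build {fraction {poly K}} laurent
  laurent_of_ratfun laurent_of_ratfun_is_zmod_morphism.
HB.instance Definition _ := GRing.isMonoidMorphism.Build {fraction {poly K}} laurent
  laurent_of_ratfun laurent_of_ratfun_is_monoid_morphism.

Lemma laurent_of_ratfun_tofrac (p : {poly K}) :
  laurent_of_ratfun (FracField.tofrac p) = laurent_of_poly p.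
Proof.
have -> : FracField.tofrac p = \pi_{fraction {poly K}} (Ratio p 1) by rewrite piE.
by rewrite laurent_of_ratfun_pi !numden_Ratio ?oner_eq0// rmorph1 divr1.
Qed.

End LaurentSeries.

Opaque lmul linv.

Notation "x %:F" := (@FracField.tofrac _ x) : ring_scope.

Section AbsoluteValue.
Variables (K : fieldType) (R : realType) (q : R).

(* [q] is the value of |t|. *)
Definition labs (f : laurent K) : R :=
  if f == 0 then 0 else q ^ xget 0 [set n | has_degree f n].

Definition laurent_cvg (u : nat -> laurent K) (l : laurent K) : Prop :=
  (fun n => labs (u n - l)) @ \oo --> (0 : R).

(* The default value 0 is only taken when [u] diverges; continued fractions with
   partial quotients of positive degree converge by [cfrac_cvg], and limits are
   unique by [laurent_cvg_unique]. *)
Definition laurent_lim (u : nat -> laurent K) : laurent K :=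
  xget 0 [set l | laurent_cvg u l].

Lemma labsE (f : laurent K) n : has_degree f n -> labs f = q ^ n.
Proof.
move=> fn; rewrite /labs (negPf (has_degree_neq0 fn)); congr (_ ^ _).
by apply: xget_unique => // m fm; exact: has_degree_inj fm fn.
Qed.

Lemma labs0 : labs 0 = 0. Proof. by rewrite /labs eqxx. Qed.

Hypothesis q1 : 1 < q.
Let q0 : 0 < q. Proof. exact: lt_trans q1. Qed.

Lemma labs_ge0 (f : laurent K) : 0 <= labs f.
Proof. by rewrite /labs; case: ifP => // _; rewrite exprz_ge0// ltW. Qed.

Lemma labs_eq0 (f : laurent K) : (labs f == 0) = (f == 0).
Proof.
rewrite /labs; case: ifP => f0; first by rewrite eqxx.
by rewrite expfz_eq0 (gt_eqF q0) andbF.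
Qed.

Lemma labs_le (f : laurent K) n : bounded_above_by n f -> labs f <= q ^ n.
Proof.
move=> fn; have [->|f0] := eqVneq f 0; first by rewrite labs0 exprz_ge0// ltW.
have [m mn fm] := has_degree_ex_le f0 fn.
by rewrite (labsE fm) ler_weXz2l// ltW.
Qed.

Lemma labsN (f : laurent K) : labs (- f) = labs f.
Proof.
have [->|f0] := eqVneq f 0; first by rewrite oppr0.
have [n fn] := has_degree_ex f0; rewrite (labsE fn); apply: labsE.
case: fn => fn0 fn; split; first by rewrite lcoefN oppr_eq0.
exact: (bounded_opp fn).
Qed.

Lemma labsD (f g : laurent K) : labs (f + g) <= Num.max (labs f) (labs g).
Proof.
have [->|f0] := eqVneq f 0; first by rewrite add0r le_max lexx orbT.
have [->|g0] := eqVneq g 0; first by rewrite addr0 le_max lexx.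
have [n fn] := has_degree_ex f0; have [m gm] := has_degree_ex g0.
rewrite (labsE fn) (labsE gm).
have [nm|mn] := leP n m.
  apply: (@le_trans _ _ (q ^ m)); last by rewrite le_max lexx orbT.
  by apply: labs_le; apply: bounded_add gm.2; exact: bounded_le fn.2.
apply: (@le_trans _ _ (q ^ n)); last by rewrite le_max lexx.
by apply: labs_le; apply: bounded_add fn.2 _; exact: bounded_le (ltW mn) gm.2.
Qed.

Lemma laurent_cvg_unique u l l' : laurent_cvg u l -> laurent_cvg u l' -> l = l'.
Proof.
move=> ul ul'; apply/eqP; rewrite -subr_eq0 -labs_eq0.
rewrite eq_le labs_ge0 andbT.
have h : (fun n => labs (u n - l) + labs (u n - l')) @ \oo --> (0 : R).
  by rewrite -[0 in X in _ --> X]addr0; exact: cvgD.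
apply: (ler_cvg_to _ h); first exact: cvg_cst.
apply: nearW => n; have -> : l - l' = - (u n - l) + (u n - l') by ring.
apply: le_trans (labsD _ _) _; rewrite labsN ge_max.
by rewrite lerDl lerDr !labs_ge0.
Qed.

Lemma laurent_limE u l : laurent_cvg u l -> laurent_lim u = l.
Proof. by move=> ul; apply: xget_unique => // m /laurent_cvg_unique; apply. Qed.

Lemma laurent_cvg_bounded (u : nat -> laurent K) (l : laurent K) :
  (forall n : nat, bounded_above_by (- n.+1%:Z) (u n - l)) -> laurent_cvg u l.
Proof.
move=> ul; apply: (@squeeze_cvgr _ _ _ _ (fun=> 0) (geometric 1 q^-1)).
- apply: nearW => n; rewrite labs_ge0 /= mul1r.
  apply: (le_trans (labs_le (ul n))); rewrite exprVn exprnN.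
  by rewrite ler_weXz2l ?(ltW q1)//; lia.
- exact: cvg_cst.
- by apply: cvg_geometric; rewrite gtr0_norm ?invr_gt0// invf_lt1.
Qed.

End AbsoluteValue.

(* [cfrac a n] is the finite continued fraction [a 0; a 1, ..., a n]. *)
Fixpoint cfrac (F : fieldType) (a : nat -> F) (n : nat) : F :=
  if n is m.+1 then a 0 + (cfrac (fun i => a i.+1) m)^-1 else a 0.

Definition cfrac_lim (K : fieldType) (R : realType) (q : R)
    (a : nat -> {poly K}) : laurent K :=
  laurent_lim q (cfrac (fun i => laurent_of_poly (a i))).

Section CfracConvergence.
Variable K : fieldType.

Definition has_pos_degree (f : laurent K) := exists2 n, 0 < n & has_degree f n.

Lemma pos_degreeV (f : laurent K) : has_pos_degree f -> bounded_above_by (-1) f^-1.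
Proof.
by move=> [n n0 fn]; apply: bounded_le (has_degreeV fn).2; lia.
Qed.

Lemma cfrac_pos_degree (a : nat -> laurent K) n :
  (forall i, has_pos_degree (a i)) -> has_pos_degree (cfrac a n).
Proof.
elim: n a => [|n IH] a a_pos /=; first exact: a_pos.
have /pos_degreeV c1 := IH _ (fun i => a_pos i.+1).
have [d d0 [ad0 ad]] := a_pos 0; exists d => //; split.
  by rewrite lcoefD c1 ?addr0//; lia.
by apply: (bounded_add ad); apply: bounded_le c1; lia.
Qed.

Lemma cfrac_cauchy (a : nat -> laurent K) n m :
  (forall i, has_pos_degree (a i.+1)) -> (n <= m)%N ->
  bounded_above_by (- n.+1%:Z) (cfrac a m - cfrac a n).
Proof.
elim: n a m => [|n IH] a [|m] a_pos // nm.
- by rewrite subrr.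
- have -> : cfrac a m.+1 - cfrac a 0 = (cfrac (fun i => a i.+1) m)^-1.
    by rewrite [cfrac a _]/= addrC addKr.
  by apply: pos_degreeV; exact: cfrac_pos_degree.
pose x := cfrac (fun i => a i.+1) m; pose y := cfrac (fun i => a i.+1) n.
have xP : has_pos_degree x by exact: cfrac_pos_degree.
have yP : has_pos_degree y by exact: cfrac_pos_degree.
have x0 : x != 0 by case: xP => d _ /has_degree_neq0.
have y0 : y != 0 by case: yP => d _ /has_degree_neq0.
have -> : cfrac a m.+1 - cfrac a n.+1 = - (x - y) * (x^-1 * y^-1).
  rewrite opprB mulrBl mulrCA mulfV// mulr1 mulrA mulfV// mul1r.
  by rewrite -[cfrac a m.+1]/(a 0 + x^-1) -[cfrac a n.+1]/(a 0 + y^-1) opprD addrACA subrr add0r.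
have xy : bounded_above_by (- n.+1%:Z) (x - y) by apply: IH => // i; exact: a_pos.
have := convolution_bounded (bounded_opp xy)
  (convolution_bounded (pos_degreeV xP) (pos_degreeV yP)).
by apply: bounded_le; lia.
Qed.

Lemma cfrac_cvg (R : realType) (q : R) (a : nat -> {poly K}) : 1 < q ->
  (forall i, (1 < size (a i.+1))%N) ->
  laurent_cvg q (cfrac (fun i => laurent_of_poly (a i))) (cfrac_lim q a).
Proof.
move=> q1 a_pos; set u := cfrac _.
have u_cauchy n m : (n <= m)%N -> bounded_above_by (- n.+1%:Z) (u m - u n).
  apply: cfrac_cauchy => i; have a1 := a_pos i; have a0 := ltnW a1.
  exists (size (a i.+1)).-1%:Z; first by rewrite ltz_nat -ltnS prednK.
  split; first by rewrite /= -[_`__]/(lead_coef _) lead_coef_eq0 -size_poly_gt0.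
  by case=> // k; rewrite ltz_nat => ki /=; rewrite nth_default// -(prednK a0).
have u_stable n m i : (n <= m)%N -> - n.+1%:Z < i -> u m i = u n i.
  by move=> nm ni; apply/eqP; rewrite -subr_eq0 -lcoefB (u_cauchy n m).
pose l i := u (absz i) i.
have [N uN] := lcoef_bound (u 0).
have lb : bounded_above_by (Num.max 0 N) l.
  move=> i; rewrite gt_max => /andP[i0 Ni].
  by rewrite /l (@u_stable 0 (absz i)) ?uN//; lia.
suff ul : laurent_cvg q u (Laurent (has_bounded_supportI lb)).
  by rewrite /cfrac_lim (laurent_limE q1 ul).
apply: laurent_cvg_bounded => // n i ni; rewrite lcoefB /= /l.
have [ni'|ni'] := leqP n (absz i).
  by rewrite (@u_stable n (absz i)) ?subrr.
by rewrite (@u_stable (absz i) n) ?subrr//; lia.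
Qed.

End CfracConvergence.

Section Morphisms.
Variable T : Type.

(* The endomorphism of the free monoid [seq T] extending [s]. *)
Definition word_morphism (s : T -> seq T) (w : seq T) : seq T :=
  flatten (map s w).

(* The infinite word having every [s^n(x)] as a prefix, for [s] prolongable on
   [x]. The [n]-th letter is read off [s^n(x)], which has more than [n] letters. *)
Definition fixed_point (s : T -> seq T) (x : T) (n : nat) : T :=
  nth x (iter n (word_morphism s) [:: x]) n.

End Morphisms.

Inductive letter := LA | LB.

Definition sigma (x : letter) : seq letter :=
  match x with LA => [:: LA; LB] | LB => [:: LA; LA] end.

Definition period_doubling : nat -> letter := fixed_point sigma LA.

Lemma size_sigma w : size (word_morphism sigma w) = (size w).*2.
Proof. by elim: w => //= -[] w IH /=; rewrite IH. Qed.

Lemma size_sigma_iter n : size (iter n (word_morphism sigma) [:: LA]) = (2 ^ n)%N.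
Proof. by elim: n => //= n IH; rewrite size_sigma IH expnS mul2n. Qed.

Lemma sigma_iter_prefix n : exists w,
  iter n.+1 (word_morphism sigma) [:: LA] = iter n (word_morphism sigma) [:: LA] ++ w.
Proof.
elim: n => [|n [w IH]]; first by exists [:: LB].
exists (word_morphism sigma w); rewrite iterS {1}IH.
by rewrite /word_morphism map_cat flatten_cat.
Qed.

Lemma period_doubling_prefix n i : (i < 2 ^ n)%N ->
  nth LA (iter n (word_morphism sigma) [:: LA]) i = period_doubling i.
Proof.
have step k m : (i < 2 ^ k)%N -> nth LA (iter (k + m) (word_morphism sigma) [:: LA]) i =
    nth LA (iter k (word_morphism sigma) [:: LA]) i.
  move=> ik; elim: m => [|m IH]; first by rewrite addn0.
  have [w ew] := sigma_iter_prefix (k + m).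
  rewrite addnS ew nth_cat size_sigma_iter IH ifT//.
  by apply: leq_trans ik _; rewrite leq_exp2l// leq_addr.
move=> i_n; rewrite /period_doubling /fixed_point.
have [ni|ni] := leqP n i.
  by have := step n (i - n)%N i_n; rewrite subnKC.
by have := step i (n - i)%N (@ltn_expl 2 i isT); rewrite (subnKC (ltnW ni)).
Qed.

Lemma period_doubling_fixed n :
  word_morphism sigma (mkseq period_doubling n) = mkseq period_doubling n.*2.
Proof.
have wE k : iter k (word_morphism sigma) [:: LA] = mkseq period_doubling (2 ^ k).
  apply: (@eq_from_nth _ LA) => [|i]; first by rewrite size_mkseq size_sigma_iter.
  by rewrite size_sigma_iter => ik; rewrite nth_mkseq// period_doubling_prefix.
have n2 : (n <= 2 ^ n)%N by rewrite ltnW// ltn_expl.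
have : word_morphism sigma (mkseq period_doubling (2 ^ n)) =
       mkseq period_doubling (2 ^ n).*2.
  by rewrite -wE -iterS wE expnS mul2n.
rewrite -(subnKC n2) doubleD /mkseq !iotaD !map_cat {1}/word_morphism map_cat flatten_cat.
move/(congr1 (take n.*2)); rewrite !take_size_cat//.
  by rewrite size_map size_iota.
by rewrite -[flatten _]/(word_morphism sigma (mkseq period_doubling n)) size_sigma size_mkseq.
Qed.

Definition interpret (T : Type) (a b : T) (x : letter) : T :=
  match x with LA => a | LB => b end.

(* alpha_p, with |t| = q *)
Definition alpha_pd (R : realType) (q : R) (a b : {poly 'F_2}) : laurent 'F_2 :=
  cfrac_lim q (fun n => interpret a b (period_doubling n)).

(* Main.v *)
Require Import Defs.
From mathcomp Require Import all_boot all_order all_algebra fraction reals.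
From mathcomp Require Import zify ring.
From mathcomp Require Import boolp classical_sets topology normedtype sequences.

Set Implicit Arguments.
Unset Strict Implicit.
Unset Printing Implicit Defensive.

Import Order.TTheory GRing.Theory Num.Theory.
Import numFieldNormedType.Exports.
Local Open Scope classical_set_scope.
Local Open Scope ring_scope.

(** The word sigma^n(a) without its last letter is a palindrome w_n, and
    w_(n+1) = w_n x_n w_n with x_n alternating between a and b.  So the
    continuant matrix of w_n is symmetric; in characteristic 2, where it has
    determinant 1, its first column (p_n, q_n) satisfies
    p_(n+1) = x_n p_n^2 and q_(n+1) = x_n p_n q_n + 1.  Writing Q for the
    reciprocal polynomial of P, Q is a constant plus an additive polynomial in
    characteristic 2, and an induction on even n gives
    Q(q_n / p_n) = p_n^-4 + b (a + b) p_n^-2, which tends to 0 while p_n / q_n,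
    a convergent of alpha_p, tends to alpha_p. *)

(** * Palindromic prefixes of the period-doubling word *)

Definition alternating_letter (n : nat) : letter := if odd n then LB else LA.

Fixpoint pal (n : nat) : seq letter :=
  if n is m.+1 then pal m ++ alternating_letter m :: pal m else [::].

Lemma size_pal n : (size (pal n)).+1 = (2 ^ n)%N.
Proof. by elim: n => //= n IH; rewrite size_cat /= addnS -addSn IH expnS; lia. Qed.

Lemma word_morphism_iter_cat T (s : T -> seq T) n u v :
  iter n (word_morphism s) (u ++ v) =
  iter n (word_morphism s) u ++ iter n (word_morphism s) v.
Proof. by elim: n => //= n ->; rewrite /word_morphism map_cat flatten_cat. Qed.

(** The two images are handled together because sigma^(n+1)(a) = sigma^n(a) sigma^n(b) and
    sigma^(n+1)(b) = sigma^n(a) sigma^n(a); only the last letter tells sigma^n(a) from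
    sigma^n(b). *)
Lemma sigma_iter_pal n :
  iter n (word_morphism sigma) [:: LA] = rcons (pal n) (alternating_letter n) /\
  iter n (word_morphism sigma) [:: LB] = rcons (pal n) (alternating_letter n.+1).
Proof.
elim: n => // n [IHa IHb]; rewrite !iterSr.
rewrite -[word_morphism sigma [:: LA]]/([:: LA] ++ [:: LB]).
rewrite -[word_morphism sigma [:: LB]]/([:: LA] ++ [:: LA]).
rewrite !word_morphism_iter_cat IHa IHb !cat_rcons -!rcons_cons -!rcons_cat.
by split=> //; congr rcons; rewrite /alternating_letter /= negbK.
Qed.

Lemma pal_period_doubling n : pal n = mkseq period_doubling (size (pal n)).
Proof.
apply: (@eq_from_nth _ LA) => [|i i_lt]; first by rewrite size_mkseq.
rewrite nth_mkseq// -(@period_doubling_prefix n); last first.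
  by rewrite -size_pal ltnS ltnW.
by rewrite (sigma_iter_pal n).1 nth_rcons i_lt.
Qed.

(** * Continuants and finite continued fractions *)

Section Continuants.
Variable R : comNzRingType.

(* The action of the matrix [[c, 1], [1, 0]] on column vectors. *)
Definition cfrac_step (c : R) (v : R * R) : R * R := (c * v.1 + v.2, v.1).

Definition cfrac_act (w : seq R) (v : R * R) : R * R := foldr cfrac_step v w.

End Continuants.

Lemma leq_size_mul (R : idomainType) (c p : {poly R}) :
  c != 0 -> (size p <= size (c * p)%R)%N.
Proof.
have [->|p0] := eqVneq p 0; first by rewrite mulr0.
move=> c0; rewrite size_mul//.
by rewrite -(prednK (_ : 0 < size c)%N) ?size_poly_gt0// addSn leq_addl.
Qed.

Lemma ltn_size_mul (R : idomainType) (c p : {poly R}) :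
  (1 < size c)%N -> p != 0 -> (size p < size (c * p)%R)%N.
Proof.
move=> c1 p0; have c0 : c != 0 by rewrite -size_poly_gt0 ltnW.
by rewrite size_mul//; case: (size c) c1 => [|[|k]] // _; rewrite !addSn /= ltnS leq_addl.
Qed.

Section ContinuedFraction.
Variable K : fieldType.

(** The product [c * x] outweighs [y], so the gap in degree persists. It makes the numerator
    nonzero, which [cfrac_actE] needs to invert a tail. *)
Lemma size_cfrac_act (w : seq {poly K}) : all (fun c : {poly K} => 1 < size c)%N w ->
  (size (cfrac_act w (1, 0)%R).2 < size (cfrac_act w (1, 0)%R).1)%N.
Proof.
elim: w => [|c w IH] /=; first by rewrite size_poly1 size_poly0.
move=> /andP[c1 /IH]; rewrite -/(cfrac_act w _).
case: (cfrac_act w _) => x y /= yx.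
have x0 : x != 0 by rewrite -size_poly_gt0 (leq_ltn_trans _ yx).
have x_lt := ltn_size_mul c1 x0.
by rewrite size_polyDl// (ltn_trans yx x_lt).
Qed.

(** Peel off the first partial quotient: if the tail is x / y, then s_0 + y / x = (s_0 x + y) / x,
    which is [cfrac_step] applied to (x, y). *)
Lemma cfrac_actE (s : nat -> {poly K}) n : (forall i, (1 < size (s i))%N) ->
  cfrac (fun i => laurent_of_poly (s i)) n =
  laurent_of_poly (cfrac_act (mkseq s n.+1) (1, 0)).1 /
  laurent_of_poly (cfrac_act (mkseq s n.+1) (1, 0)).2.
Proof.
elim: n s => [|n IH] s s1; first by rewrite /= mulr1 addr0 rmorph1 divr1.
have -> : mkseq s n.+2 = s 0 :: mkseq (fun i => s i.+1) n.+1.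
  rewrite /mkseq -[iota 0 n.+2]/(0%N :: iota (1 + 0) n.+1) iotaDl.
  by rewrite [LHS]/= -map_comp.
have /size_cfrac_act : all (fun c : {poly K} => 1 < size c)%N
    (mkseq (fun i => s i.+1) n.+1) by apply/allP => c /mapP[i _ ->]; exact: s1.
rewrite [LHS]/= (IH (fun i => s i.+1))// => {IH}; move: (mkseq _ _) => w.
rewrite -[cfrac_act (_ :: w) _]/(cfrac_step (s 0) (cfrac_act w _)).
case: (cfrac_act _ _) => x y /= yx.
have x0 : laurent_of_poly x != 0.
  rewrite -(rmorph0 (@laurent_of_poly K)) (inj_eq (@laurent_of_poly_inj K)).
  by rewrite -size_poly_gt0 (leq_ltn_trans _ yx).
by rewrite invf_div rmorphD rmorphM mulrDl mulfK.
Qed.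

End ContinuedFraction.

(** * Continuants of the palindromes in characteristic 2 *)

Section CharacteristicTwo.
Variables (R : comNzRingType) (R2 : 2%N \in [pchar R]) (a b : R).

Definition pal_act n : R * R -> R * R := cfrac_act (map (interpret a b) (pal n)).

Fixpoint pal_num n : R :=
  if n is m.+1 then interpret a b (alternating_letter m) * pal_num m ^+ 2 else 1.

Fixpoint pal_den n : R :=
  if n is m.+1
  then interpret a b (alternating_letter m) * pal_num m * pal_den m + 1 else 0.

(** The witness [r] completes the symmetric matrix M = [[p, d], [d, r]] of w_n, whose determinant p
    r - d^2 is written with a plus sign. *)
Lemma pal_actE n : exists2 r, pal_num n * r + pal_den n ^+ 2 = 1 &
  forall v, pal_act n v =
    (pal_num n * v.1 + pal_den n * v.2, pal_den n * v.1 + r * v.2).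
Proof.
have dbl (z : R) : z + z = 0 by exact: addrr_pchar2.
elim: n => [|n [r det IH]].
  exists 1; first by rewrite /=; ring.
  by case=> x y; rewrite /pal_act /=; congr (_, _); ring.
rewrite /=; set c := interpret _ _ _.
set p := pal_num n in det IH *; set d := pal_den n in det IH *.
(* The lower right entry of M [[c, 1], [1, 0]] M is c d^2 + 2 d r. *)
exists (c * d ^+ 2).
  have -> : c * p ^+ 2 * (c * d ^+ 2) + (c * p * d + 1) ^+ 2 =
    1 + (c * p * d * (c * p * d + 1) + c * p * d * (c * p * d + 1)) by ring.
  by rewrite dbl addr0.
move=> [x y]; rewrite /pal_act /cfrac_act /= map_cat foldr_cat /=.
(* With 1 replaced by p r + d^2, the two components agree up to 2 p d x and 2 r d y. *)
rewrite -!/(cfrac_act _ _) -!/(pal_act n _) !IH /= -/c -det.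
congr (_, _).
  by rewrite -[RHS]addr0 -(dbl (p * d * x)); ring.
by rewrite -[RHS]addr0 -(dbl (r * d * y)); ring.
Qed.

Lemma pal_act10 n : pal_act n (1, 0) = (pal_num n, pal_den n).
Proof. by have [r _ ->] := pal_actE n; rewrite !mulr1 !mulr0 !addr0. Qed.

(** The left side is p^4 Q(d / p) cleared of denominators. The induction advances by two letters, a
    then b, hence the even index. *)
Lemma pal_quartic m (p := pal_num m.*2) (d := pal_den m.*2) :
  (a * b + b ^+ 2 + 1) * p ^+ 4 + a * b * (a + b) * p ^+ 3 * d
    + a * b * p ^+ 2 * d ^+ 2 + d ^+ 4 = 1 + b * (a + b) * p ^+ 2.
Proof.
have dbl (z : R) : z + z = 0 by exact: addrr_pchar2.
have sqD (x y : R) : (x + y) ^+ 2 = x ^+ 2 + y ^+ 2.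
  by rewrite -[RHS]addr0 -(dbl (x * y)); ring.
rewrite {}/p {}/d; elim: m => [|m]; first by rewrite /=; ring.
rewrite doubleS /= /alternating_letter /= odd_double /=.
set p := pal_num _; set d := pal_den _ => IH.
set d' := b * _ * _ + 1.
(* Since squaring is additive, [d'], [d' ^+ 2] and [d' ^+ 4] each contain [d] in a single monomial,
   so the old quartic reappears scaled by a^8 b^4 p^12. *)
have d'2 : d' ^+ 2 = a ^+ 4 * b ^+ 2 * p ^+ 6 * d ^+ 2 + a ^+ 2 * b ^+ 2 * p ^+ 4 + 1.
  by rewrite /d' sqD mulrDr sqD; ring.
have d'4 : d' ^+ 4 =
    a ^+ 8 * b ^+ 4 * p ^+ 12 * d ^+ 4 + a ^+ 4 * b ^+ 4 * p ^+ 8 + 1.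
  by rewrite -[4%N]/(2 * 2)%N exprM d'2 !sqD; ring.
rewrite d'2 d'4.
(* Over the integers, the new identity is [a^8 b^4 p^12] times the old one plus [2 z]. *)
pose z := a ^+ 8 * b ^+ 5 * (a + b) * p ^+ 14 + a ^+ 8 * b ^+ 4 * p ^+ 12
  + a ^+ 7 * b ^+ 5 * p ^+ 12.
apply/eqP; rewrite -subr_eq0 -(dbl z) -[X in _ == X]addr0.
rewrite -(mulr0 (a ^+ 8 * b ^+ 4 * p ^+ 12)) -(subrr (1 + b * (a + b) * p ^+ 2)).
by rewrite -[X in _ == _ + _ * (X - _)]IH /z /d'; apply/eqP; ring.
Qed.

End CharacteristicTwo.

(** * Degree bounds for Laurent series *)

Section BoundedDegree.
Variable K : fieldType.
Implicit Types f g : laurent K.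

Lemma laurent_bounded_add N f g : bounded_above_by N f -> bounded_above_by N g ->
  bounded_above_by N (f + g).
Proof. exact: bounded_add. Qed.

Lemma laurent_bounded_mul N M f g : bounded_above_by N f -> bounded_above_by M g ->
  bounded_above_by (N + M) (f * g).
Proof. by move=> fN gM i Ni; rewrite lcoefM (convolution_bounded fN gM). Qed.

Lemma laurent_bounded_sqr N f : bounded_above_by N f -> bounded_above_by (2 * N) (f ^+ 2).
Proof. by move=> fN; rewrite (_ : 2 * N = N + N); [exact: laurent_bounded_mul|lia]. Qed.

(** Trades absolute values for degrees: as q > 1, |f| < q^k forces the degree of a nonzero f below
    k. *)
Lemma laurent_cvg_eventually (R : realType) (q : R) (u : nat -> laurent K) l :
  1 < q -> laurent_cvg q u l ->
  forall k, exists N, forall n, (N <= n)%N -> bounded_above_by k (u n - l).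
Proof.
move=> q1 ul k; have qk0 : 0 < q ^ k by rewrite exprz_gt0// (lt_trans _ q1).
have [N _ uN] := cvgr0_norm_lt _ ul _ qk0.
exists N => n /uN; rewrite (ger0_norm (labs_ge0 q1 _)).
have [-> _ i _|un0] := eqVneq (u n - l) 0; first by rewrite lcoef0.
have [m um] := has_degree_ex un0; rewrite (labsE q um) ltr_eXz2l// => mk.
exact: bounded_le (ltW mk) um.2.
Qed.

Lemma laurent_eq0 f : (forall k, bounded_above_by k f) -> f = 0.
Proof. by move=> f0; apply: laurentP => i; apply: (f0 (i - 1)); lia. Qed.

Lemma has_degree_poly (p : {poly K}) : p != 0 ->
  has_degree (laurent_of_poly p) (size p).-1%:Z.
Proof.
move=> p0; split; first by rewrite /= -[_`__]/(lead_coef _) lead_coef_eq0.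
case=> // k; rewrite ltz_nat => ki /=; rewrite nth_default//.
by rewrite -(prednK (_ : (0 < size p)%N)) ?size_poly_gt0.
Qed.

End BoundedDegree.

(** * Convergents of alpha_p at the palindromic prefixes *)

Section PeriodDoubling.
Variables a b : {poly 'F_2}.
Hypotheses (a_nonconst : (1 < size a)%N) (b_nonconst : (1 < size b)%N).

Let pchar2 : 2%N \in [pchar {poly 'F_2}].
Proof. by rewrite pchar_lalg pchar_Fp. Qed.

Let size_interpret x : (1 < size (interpret a b x))%N.
Proof. by case: x. Qed.

(** Each step squares p_n and multiplies by a non-constant letter. This crude linear growth already
    makes 1 / p_n tend to 0. *)
Lemma size_pal_num n : (n < size (pal_num a b n))%N.
Proof.
elim: n => [|n IH] /=; first by rewrite size_poly1.
have := size_interpret (alternating_letter n); set c := interpret _ _ _ => c1.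
have p0 : pal_num a b n != 0 by rewrite -size_poly_gt0 (leq_ltn_trans _ IH).
apply: leq_ltn_trans (ltn_size_mul c1 (expf_neq0 2 p0)).
by rewrite expr2 (leq_trans IH)// leq_size_mul.
Qed.

(** The product x_n p_n q_n is either zero or non-constant, so adding 1 cannot cancel it. *)
Lemma pal_den_neq0 n : (0 < n)%N -> pal_den a b n != 0.
Proof.
case: n => // n _ /=; set c := interpret _ _ _.
have c1 : (1 < size c)%N := size_interpret _.
have p1 := size_pal_num n.
have [->|d0] := eqVneq (pal_den a b n) 0; first by rewrite mulr0 add0r oner_neq0.
have p0 : pal_num a b n != 0 by rewrite -size_poly_gt0 (leq_ltn_trans _ p1).
have cpd : (1 < size (c * pal_num a b n * pal_den a b n)%R)%N.
  rewrite -mulrA (leq_ltn_trans _ (ltn_size_mul c1 (mulf_neq0 p0 d0)))//.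
  by rewrite size_poly_gt0 mulf_neq0.
by rewrite -size_poly_gt0 size_polyDl ?size_poly1// ltnW.
Qed.

(** The predecessor appears because [cfrac s k] reads k + 1 letters; w_n is nonempty for n > 0. *)
Lemma cfrac_pal n : (0 < n)%N ->
  cfrac (fun i => laurent_of_poly (interpret a b (period_doubling i)))
    (size (pal n)).-1 =
  laurent_of_poly (pal_num a b n) / laurent_of_poly (pal_den a b n).
Proof.
move=> n0; rewrite cfrac_actE//.
have -> : (size (pal n)).-1.+1 = size (pal n).
  by case: n n0 => // n _; rewrite /= size_cat addnS.
have -> : mkseq (fun i => interpret a b (period_doubling i)) (size (pal n)) =
    map (interpret a b) (pal n).
  by rewrite [in RHS]pal_period_doubling /mkseq -map_comp.
by rewrite -/(pal_act a b n _) pal_act10.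
Qed.

End PeriodDoubling.

(** * Vanishing of P at alpha_p *)

Lemma quartic_fraction (F : fieldType) (A B C D p d : F) : p != 0 -> d != 0 ->
  A * p ^+ 4 + B * p ^+ 3 * d + C * p ^+ 2 * d ^+ 2 + d ^+ 4 = 1 + D * p ^+ 2 ->
  A * (p / d) ^+ 4 + B * (p / d) ^+ 3 + C * (p / d) ^+ 2 + 1 =
  ((p / d) ^+ 2) ^+ 2 * (p^-1 * (p^-1 * (p^-1 ^+ 2 + D))).
Proof.
move=> p0 d0 pd; transitivity ((A * p ^+ 4 + B * p ^+ 3 * d
    + C * p ^+ 2 * d ^+ 2 + d ^+ 4) / d ^+ 4); first by field.
by rewrite pd; field; rewrite d0 p0.
Qed.

Lemma quartic_diff (R : comNzRingType) (A B C x c : R) :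
  A * x ^+ 4 + B * x ^+ 3 + C * x ^+ 2 + 1 =
  (A * c ^+ 4 + B * c ^+ 3 + C * c ^+ 2 + 1)
  + - ((c - x) * (A * ((x + c) * (x ^+ 2 + c ^+ 2))
      + (B * (x ^+ 2 + x * c + c ^+ 2) + C * (x + c)))).
Proof. by ring. Qed.

Lemma alpha_pd_quartic (R : realType) (q : R) (a b : {poly 'F_2}) :
  1 < q -> (1 < size a)%N -> (1 < size b)%N ->
  let L := @laurent_of_poly 'F_2 in
  let x := alpha_pd q a b in
  L (a * b + b ^+ 2 + 1) * x ^+ 4 + L (a * b * (a + b)) * x ^+ 3
    + L (a * b) * x ^+ 2 + 1 = 0.
Proof.
move=> q1 a1 b1 L x; apply: laurent_eq0 => k.
(* One nonnegative [M] bounds the degrees of alpha_p, A, B, C and b (a + b). *)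
have [] : exists M : nat, [/\ bounded_above_by M%:Z x,
    bounded_above_by M%:Z (L (a * b + b ^+ 2 + 1)),
    bounded_above_by M%:Z (L (a * b * (a + b))),
    bounded_above_by M%:Z (L (a * b)) & bounded_above_by M%:Z (L (b * (a + b)))].
  have [N0 ?] := lcoef_bound x.
  have [N1 ?] := lcoef_bound (L (a * b + b ^+ 2 + 1)).
  have [N2 ?] := lcoef_bound (L (a * b * (a + b))).
  have [N3 ?] := lcoef_bound (L (a * b)).
  have [N4 ?] := lcoef_bound (L (b * (a + b))).
  exists (`|N0| + `|N1| + `|N2| + `|N3| + `|N4|)%N.
  by split; eapply bounded_le; try eassumption; lia.
move=> M [xM AM BM CM DM].
have u_cvg : laurent_cvg q (cfrac (fun i =>
    laurent_of_poly (interpret a b (period_doubling i)))) x.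
  by apply: cfrac_cvg => // i; case: (period_doubling _).
(* The cofactor of c - x in [quartic_diff] has degree at most 4 M; this precision brings the product
   down to -|k|. *)
have [N uN] := laurent_cvg_eventually q1 u_cvg (- (`|k| + 4 * M)%N%:Z).
(* The summand [N] reaches the convergents that are close enough; the rest makes P(c), of degree at
   most 5 M - 4 m, fall below k. *)
pose m := (N + `|k| + 5 * M).+1.
have m0 : (0 < m.*2)%N by [].
have := uN (size (pal m.*2)).-1.
have -> : (N <= (size (pal m.*2)).-1)%N.
  by have := size_pal m.*2; have := @ltn_expl 2 m.*2 isT; rewrite /m; lia.
move=> /(_ isT); rewrite cfrac_pal//.
have := @pal_quartic _ _ a b m.
have := size_pal_num a1 b1 m.*2.
have := pal_den_neq0 a1 b1 m0.
set p := pal_num _ _ _; set d := pal_den _ _ _ => d0 p1 pd.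
have p0 : p != 0 by rewrite -size_poly_gt0 (leq_ltn_trans _ p1).
have L0 r : r != 0 -> L r != 0.
  by rewrite -(rmorph0 L) (inj_eq (@laurent_of_poly_inj _)).
have {d0} d0 := L0 _ d0; have Lp0 := L0 _ p0.
have pV : bounded_above_by (- m.*2%:Z) (L p)^-1.
  apply: bounded_le (has_degreeV (has_degree_poly p0)).2.
  by move: (size p) p1 => i; lia.
have {pd} pd : L (a * b + b ^+ 2 + 1) * L p ^+ 4
    + L (a * b * (a + b)) * L p ^+ 3 * L d
    + L (a * b) * L p ^+ 2 * L d ^+ 2 + L d ^+ 4 = 1 + L (b * (a + b)) * L p ^+ 2.
  by rewrite -!rmorphXn -!rmorphM -!rmorphD pd ?pchar_lalg ?pchar_Fp// rmorphD rmorph1.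
move: AM BM CM DM pd.
set A := L (_ + 1); set B := L (a * b * _); set C := L (a * b); set D := L (b * _).
move=> AM BM CM DM pd; set c := L p / L d => xc.
have cM : bounded_above_by M%:Z c.
  rewrite -[c](subrK x) addrC.
  by apply: bounded_add => //; apply: bounded_le xc; lia.
rewrite (quartic_diff A B C x c) (quartic_fraction Lp0 d0 pd) -/c.
apply: laurent_bounded_add; last apply: bounded_opp.
  (* P(c) = c^4 p^-1 (p^-1 (p^-2 + D)): the factor c^4 contributes at most 4 M, the innermost sum at
     most M, and each outer p^-1 at most -2 m. *)
  have pV2D : bounded_above_by M%:Z ((L p)^-1 ^+ 2 + D).
    by apply: laurent_bounded_add DM; apply: bounded_le (laurent_bounded_sqr pV); lia.
  apply: bounded_le (laurent_bounded_mul (laurent_bounded_sqr (laurent_bounded_sqr cM))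
    (laurent_bounded_mul pV (laurent_bounded_mul pV pV2D))).
  by rewrite /m; lia.
have x2 := laurent_bounded_sqr xM; have c2 := laurent_bounded_sqr cM.
have AM' := laurent_bounded_mul AM
  (laurent_bounded_mul (laurent_bounded_add xM cM) (laurent_bounded_add x2 c2)).
have xcM : bounded_above_by (2 * M%:Z) (x * c).
  by apply: bounded_le (laurent_bounded_mul xM cM); lia.
have BM' := laurent_bounded_mul BM (laurent_bounded_add (laurent_bounded_add x2 xcM) c2).
have CM' := laurent_bounded_mul CM (laurent_bounded_add xM cM).
have gM : bounded_above_by (4 * M%:Z) (A * ((x + c) * (x ^+ 2 + c ^+ 2))
    + (B * (x ^+ 2 + x * c + c ^+ 2) + C * (x + c))).
  apply: laurent_bounded_add; first by apply: bounded_le AM'; lia.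
  by apply: laurent_bounded_add; [apply: bounded_le BM' | apply: bounded_le CM']; lia.
by apply: bounded_le (laurent_bounded_mul xc gM); lia.
Qed.

Lemma horner_map_quartic (F K : fieldType) (f : {rmorphism F -> K}) (A B C : F) (x : K) :
  (map_poly f (A *: 'X^4 + B *: 'X^3 + C *: 'X^2 + 1)).[x] =
  f A * x ^+ 4 + f B * x ^+ 3 + f C * x ^+ 2 + 1.
Proof. by rewrite !rmorphD rmorph1 /= !map_polyZ !map_polyXn !hornerE. Qed.

Theorem theorem1 (R : realType) (q : R) (q_gt1 : 1 < q) (a b : {poly 'F_2})
    (a_nonconst : (1 < size a)%N) (b_nonconst : (1 < size b)%N) (a_neq_b : a <> b) :
  let A := a * b + b ^+ 2 + 1 in
  let B := a * b * (a + b) in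
  let C := a * b in
  let P : {poly {fraction {poly 'F_2}}} :=
    A%:F *: 'X^4 + B%:F *: 'X^3 + C%:F *: 'X^2 + 1 in
  (map_poly (@laurent_of_ratfun _) P).[alpha_pd q a b] = 0.
Proof.
move=> A B C P; rewrite horner_map_quartic /= !laurent_of_ratfun_tofrac.
exact: alpha_pd_quartic.
Qed.
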